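(* Let $\alpha_1,\alpha_2,\beta_1,\beta_2>0$, $\nu\in(0,1)$, $\mu\geq0$, and let $\tilde X^{\nu,\mu}(t):=X^1(\tilde S^{\nu,\mu}(t))$ be the time-changed process described in the context. For $k\in\mathbb{Z}$ and $t>0$ let $\tilde F_k^{\nu,\mu}(z,t):=\mathbb{E}[z^{\tilde X^{\nu,\mu}(t)}|\tilde X^{\nu,\mu}(0)=k]=\sum_{n=-\infty}^\infty z^nP(\tilde X^{\nu,\mu}(t)=n|\tilde X^{\nu,\mu}(0)=k)$. Then, for every $z>0$: if $\hat h_+(z)\leq\mu$, $$\tilde F_k^{\nu,\mu}(z,t)=z^k\left(\frac{e^{-t((\mu-\hat h_+(z))^\nu-\mu^\nu)}+e^{-t((\mu-\hat h_-(z))^\nu-\mu^\nu)}}{2}+\frac{c_k(z)}{h(z)}\cdot\frac{e^{-t((\mu-\hat h_+(z))^\nu-\mu^\nu)}-e^{-t((\mu-\hat h_-(z))^\nu-\mu^\nu)}}{2}\right),$$ and $\tilde F_k^{\nu,\mu}(z,t)=\infty$ otherwise, where $c_k,h,\hat h_\pm$ are as in the context.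
   Context: $\{X^1(t):t\geq 0\}$ is the continuous-time Markov chain on $\mathbb{Z}$ whose state probabilities $p_{k,n}(t):=P(X^1(t)=n|X^1(0)=k)$ satisfy $p_{k,n}(0)=1_{\{k=n\}}$ and whose generator $g_{k,n}:=\lim_{t\to 0}\frac{p_{k,n}(t)-p_{k,n}(0)}{t}$ is as follows. For even $k$: $g_{k,k+1}=\alpha_1$, $g_{k,k-1}=\alpha_2$, $g_{k,k}=-(\alpha_1+\alpha_2)$. For odd $k$: $g_{k,k+1}=\beta_1$, $g_{k,k-1}=\beta_2$, $g_{k,k}=-(\beta_1+\beta_2)$. All other entries are $0$. $\{S^\nu(t):t\geq0\}$ is the $\nu$-stable subordinator: $\mathbb{E}[e^{\gamma S^\nu(t)}]=e^{-|\gamma|^\nu t}$ if $\gamma\leq0$ and $=\infty$ otherwise; $f_{S^\nu(t)}$ denotes the density of $S^\nu(t)$, $t>0$. $\{\tilde S^{\nu,\mu}(t):t\geq0\}$ is the (possibly tempered) stable subordinator, i.e. the subordinator with $\tilde S^{\nu,\mu}(0)=0$ and, for $t>0$, $P(\tilde S^{\nu,\mu}(t)\in dx)=e^{-\mu x+\mu^\nu t}f_{S^\nu(t)}(x)\,dx$ (for $\mu=0$ it is $S^\nu$). Hence for $t>0$, $\mathbb{E}[e^{\gamma\tilde S^{\nu,\mu}(t)}]=e^{-t((\mu-\gamma)^\nu-\mu^\nu)}$ if $\gamma\leq\mu$ and $=\infty$ otherwise. $\tilde S^{\nu,\mu}$ is independent of $X^1$. For $z>0$: $h(z):=\frac12\sqrt{(\alpha_1+\alpha_2-(\beta_1+\beta_2))^2z^2+4(\beta_1z^2+\beta_2)(\alpha_1z^2+\alpha_2)}$;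 $\hat h_\pm(z):=-\frac{\alpha_1+\alpha_2+\beta_1+\beta_2}{2}\pm\frac{h(z)}{z}$; $c_k(z):=\frac{(\beta_1+\beta_2-(\alpha_1+\alpha_2))z}{2}+\alpha_1z^2+\alpha_2$ if $k$ is even, and $c_k(z):=\frac{(\alpha_1+\alpha_2-(\beta_1+\beta_2))z}{2}+\beta_1z^2+\beta_2$ if $k$ is odd. *)

(* Defs.v *)
From HB Require Import structures.
From mathcomp Require Import all_boot all_order all_algebra.
From mathcomp Require Import all_classical all_reals all_analysis.

Set Implicit Arguments.
Unset Strict Implicit.
Unset Printing Implicit Defensive.

Import Order.TTheory GRing.Theory Num.Theory.
Import numFieldNormedType.Exports.

Local Open Scope classical_set_scope.
Local Open Scope ring_scope.

(* Processes are indexed by R; only their values at times t >= 0 matter. *)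

Section conditioning.
Local Open Scope ereal_scope.
Context d (T : measurableType d) (R : realType) (P : probability T R).

(* Elementary conditioning on an event B, meaningful when 0 < P B. *)
Definition cond_prob (A B : set T) : \bar R := P (A `&` B) / P B.

Definition cond_expectation (Y : T -> R) (B : set T) : \bar R :=
  (\int[P]_(w in B) (Y w)%:E) / P B.

End conditioning.

Section processes.
Context d (T : measurableType d) (R : realType) (P : probability T R).

(* The sigma-algebra sigma(X t : t >= 0), where the state space carries the
   sigma-algebra G. *)
Definition process_sigma (U : Type) (G : set (set U)) (X : R -> T -> U) :
    set (set T) :=
  <<s [set X t @^-1` B | t in [set t : R | 0 <= t] & B in G] >>.

Definition independent_sigma (F G : set (set T)) : Prop :=
  forall A B, F A -> G B -> P (A `&` B) = (P A * P B)%E.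

Definition is_density (Y : {RV P >-> R}) (f : R -> R) : Prop :=
  [/\ measurable_fun [set: R] f,
      forall x, 0 <= f x &
      forall A : set R, measurable A ->
        distribution P Y A = (\int[lebesgue_measure]_(x in A) (f x)%:E)%E].

(* A subordinator is a Levy process started at 0 with nondecreasing (hence
   nonnegative, and having left limits) right-continuous paths. *)
Record is_subordinator (S : R -> {RV P >-> R}) : Prop := {
  subordinator_start : forall w, S 0 w = 0 ;
  subordinator_homo : forall w (s t : R), 0 <= s -> s <= t -> S s w <= S t w ;
  subordinator_rcont : forall w (t : R), 0 <= t ->
    S s w @[s --> t^'+] --> S t w ;
  subordinator_stationary : forall s t : R, 0 <= s -> 0 <= t ->
    forall B : set R, measurable B ->
      P [set w | B (S (s + t) w - S s w)] = P [set w | B (S t w)] ;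
  subordinator_independent : forall (n : nat) (t : nat -> R)
      (B : nat -> set R),
    0 <= t 0%N -> {homo t : i j / (i < j)%N >-> i < j} ->
    (forall i, measurable (B i)) ->
    P [set w | forall i, (i < n)%N -> B i (S (t i.+1) w - S (t i) w)] =
      (\prod_(i < n) P [set w | B i (S (t i.+1) w - S (t i) w)%R])%E }.

Definition is_stable_subordinator (nu : R) (S : R -> {RV P >-> R}) : Prop :=
  is_subordinator S /\
  forall gamma t : R, 0 < t ->
    'E_P[fun w => expR (gamma * S t w)]%E =
      if gamma <= 0 then (expR (- (`|gamma| `^ nu * t)))%:E else +oo%E.

(* f t is meant to be a density of the nu-stable subordinator at time t > 0;
   for mu = 0 the weight is 1, because 0 `^ nu = 0 when nu != 0. *)
Definition is_tempered_stable_subordinator (nu mu : R) (f : R -> R -> R)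
    (S : R -> {RV P >-> R}) : Prop :=
  is_subordinator S /\
  forall t : R, 0 < t ->
    is_density (S t) (fun x => expR (- (mu * x) + mu `^ nu * t) * f t x).

End processes.

Section markov_chain.
Context (R : realType).

(* p t k n is the transition probability from k to n in time t. *)
Record is_transition_function (p : R -> int -> int -> R) : Prop := {
  transition_ge0 : forall (t : R) k n, 0 <= t -> 0 <= p t k n ;
  transition_sum : forall (t : R) k, 0 <= t ->
    (\esum_(n in [set: int]) (p t k n)%:E = 1)%E ;
  transition0 : forall k n, p 0 k n = (k == n)%:R ;
  transitionD : forall (s t : R) k n, 0 <= s -> 0 <= t ->
    ((p (s + t)%R k n)%:E =
      \esum_(j in [set: int]) (p s k j * p t j n)%R%:E)%E }.

Definition has_generator (p : R -> int -> int -> R) (g : int -> int -> R) :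
    Prop :=
  forall k n, (p t k n - p 0 k n) / t @[t --> 0^'+] --> g k n.

(* A continuous-time Markov chain on the integers with transition function p
   and arbitrary initial law; chain_markov is the time-homogeneous Markov
   property in terms of finite-dimensional distributions, so that
   p t k n = P(X t = n | X 0 = k) as soon as P(X 0 = k) > 0. Paths are right
   continuous for the discrete topology, which makes X (S t) measurable for
   every random time S t >= 0. *)
Record is_markov_chain d (T : measurableType d) (P : probability T R)
    (p : R -> int -> int -> R) (X : R -> T -> int) : Prop := {
  chain_transition : is_transition_function p ;
  chain_measurable : forall (t : R) (B : set int), 0 <= t ->
    measurable (X t @^-1` B) ;
  chain_rcont : forall w (t : R), 0 <= t -> \forall s \near t^'+, X s w = X t w ;
  chain_markov : forall (m : nat) (t : nat -> R) (i : nat -> int),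
    0 <= t 0%N -> {homo t : a b / (a < b)%N >-> a < b} ->
    P [set w | forall j, (j <= m)%N -> X (t j) w = i j] =
      (P [set w | X (t 0%N) w = i 0%N] *
       (\prod_(j < m) p (t j.+1 - t j) (i j) (i j.+1))%R%:E)%E }.

Definition even_int (k : int) : bool := (2 %| k)%Z.

Definition alternating_generator (a1 a2 b1 b2 : R) (k n : int) : R :=
  let: (up, down) := if even_int k then (a1, a2) else (b1, b2) in
  if n == k + 1 then up
  else if n == k - 1 then down
  else if n == k then - (up + down)
  else 0.

End markov_chain.

Definition time_change (R T U : Type) (X : R -> T -> U) (S : R -> T -> R) :
    R -> T -> U :=
  fun t w => X (S t w) w.

(* E[z^(Y t) | Y 0 = k] *)
Definition cond_pgf d (T : measurableType d) (R : realType)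
    (P : probability T R) (Y : R -> T -> int) (k : int) (z t : R) : \bar R :=
  cond_expectation P (fun w => z ^ Y t w) [set w | Y 0 w = k].

Section explicit_functions.
Context (R : realType) (a1 a2 b1 b2 : R).

Definition hfun (z : R) : R :=
  2^-1 * Num.sqrt ((a1 + a2 - (b1 + b2)) ^+ 2 * z ^+ 2 +
                   4 * (b1 * z ^+ 2 + b2) * (a1 * z ^+ 2 + a2)).

Definition hhat_plus (z : R) : R := - ((a1 + a2 + b1 + b2) / 2) + hfun z / z.

Definition hhat_minus (z : R) : R := - ((a1 + a2 + b1 + b2) / 2) - hfun z / z.

Definition cfun (k : int) (z : R) : R :=
  if even_int k then
    (b1 + b2 - (a1 + a2)) * z / 2 + a1 * z ^+ 2 + a2
  else
    (a1 + a2 - (b1 + b2)) * z / 2 + b1 * z ^+ 2 + b2.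

End explicit_functions.

(* Main.v *)
Require Import Defs.
From HB Require Import structures.
From mathcomp Require Import all_boot all_order all_algebra.
From mathcomp Require Import all_classical all_reals all_analysis.
From mathcomp Require Import measurable_realfun ring lra zify.

Import Order.TTheory GRing.Theory Num.Theory.
Import numFieldNormedType.Exports.

Local Open Scope classical_set_scope.
Local Open Scope ring_scope.

(** By the semigroup property, a transition function [p] whose generator [g] is
    tridiagonal with bounded rates and null row sums satisfies the backward
    equation [p' = g p]. Writing [l] for a bound of the rates, Taylor's formula
    for [expR (l * t) * p t k n], whose derivatives at 0 are the powers of the
    nonnegative operator [l + g], identifies [p] with the exponential series of
    [g]. Since [z ^ k] is a sum of two eigenfunctions of [g], with eigenvalues
    [hhat_plus] and [hhat_minus], the generating function of [p] is a
    combination of the two corresponding exponentials. It remains to integrate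
    it against the law of the subordinator, whose Laplace transform is obtained
    by tilting the stable density.

    Conditioning on the subordinator is done by approximating it strictly from
    above by variables taking values in a grid: independence applies on each
    grid cell, and right continuity of the chain gives the limit. *)

(** * Transition functions *)

Lemma cvg_dist_squeeze {R : realFieldType} {U : Type} {F : set_system U}
    {FF : Filter F} (e f : U -> R) (l : R) :
  e x @[x --> F] --> 0 -> (\forall x \near F, `|f x - l| <= e x) ->
  f x @[x --> F] --> l.
Proof.
move=> e0 fe.
apply: (@squeeze_cvgr _ _ _ _ (fun x => l - e x) (fun x => l + e x)).
- by apply: filterS fe => x; rewrite ler_distl.
- by rewrite -[X in _ --> X]subr0; apply: cvgB e0; exact: cvg_cst.
- by rewrite -[X in _ --> X]addr0; apply: cvgD e0; exact: cvg_cst.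
Qed.

Lemma esum_seq_setC {R : realType} {T : choiceType} (r : seq T) (a : T -> R) :
  uniq r -> (forall j, 0 <= a j) ->
  (\esum_(j in [set: T]) (a j)%:E =
   (\sum_(j <- r) a j)%:E + \esum_(j in ~` [set` r]) (a j)%:E)%E.
Proof.
move=> ur a0; rewrite (esumID [set` r]); last by move=> j _; rewrite lee_fin.
rewrite !setTI; congr (_ + _)%E.
rewrite esum_fset//; last by move=> j _; rewrite lee_fin.
by rewrite -fsbig_seq// sumEFin.
Qed.

Section transition_function.
Context (R : realType) (p : R -> int -> int -> R).
Hypothesis hp : is_transition_function p.

Lemma transition_sum_seq_le1 (r : seq int) (t : R) (k : int) :
  uniq r -> 0 <= t -> \sum_(j <- r) p t k j <= 1.
Proof.
move=> ur t0; rewrite -lee_fin -(transition_sum hp k t0).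
rewrite (@esum_seq_setC _ _ r)//; last by move=> j; exact: transition_ge0.
by rewrite leeDl// esum_ge0// => j _; rewrite lee_fin transition_ge0.
Qed.

Lemma transition_le1 (t : R) (k n : int) : 0 <= t -> p t k n <= 1.
Proof.
move=> t0; have := @transition_sum_seq_le1 [:: n] t k isT t0.
by rewrite big_seq1.
Qed.

(** In the Chapman-Kolmogorov sum the terms outside [r] are nonnegative. Since [p t j n <= 1], their
    total is at most the mass that [p s k] puts outside [r]. *)
Lemma transitionD_seq_bounds (r : seq int) (s t : R) (k n : int) :
  uniq r -> 0 <= s -> 0 <= t ->
  \sum_(j <- r) p s k j * p t j n <= p (s + t) k n <=
  \sum_(j <- r) p s k j * p t j n + (1 - \sum_(j <- r) p s k j).
Proof.
move=> ur s0 t0.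
have pp0 j : 0 <= p s k j * p t j n.
  by rewrite mulr_ge0// (transition_ge0 hp).
have := transitionD hp k n s0 t0; rewrite (@esum_seq_setC _ _ r)//.
set e2 := (X in (_ + X)%E) => eD.
have := transition_sum hp k s0; rewrite (@esum_seq_setC _ _ r)//; last first.
  by move=> j; exact: transition_ge0.
set e1 := (X in (_ + X)%E) => e1D.
have e20 : (0 <= e2)%E by apply: esum_ge0 => j _; rewrite lee_fin.
have e21 : (e2 <= e1)%E.
  apply: le_esum => j _; rewrite lee_fin ler_piMr//.
    exact: (transition_ge0 hp).
  exact: transition_le1.
move: e1 e2 e1D eD e20 e21 => [e1| |] [e2| |] //=.
rewrite -!EFinD !lee_fin => -[e1D] [->] e20 e21.
by rewrite lerDl e20/= lerD2l -e1D addrAC subrr add0r.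
Qed.

(** Take [r = [:: k]] in the preceding bounds. The right-hand side does not depend on [t], so it
    serves as a modulus of continuity. *)
Lemma transition_incr_le (s t : R) (k n : int) : 0 <= s -> 0 <= t ->
  `|p (s + t) k n - p t k n| <= 1 - p s k k.
Proof.
move=> s0 t0.
have := @transitionD_seq_bounds [:: k] s t k n isT s0 t0.
rewrite !big_seq1 ler_norml => /andP[].
have := transition_ge0 hp k n t0; have := transition_le1 t k n t0.
have := transition_ge0 hp k k s0; have := transition_le1 s k k s0.
by nra.
Qed.

Section generator.
Context (g : int -> int -> R).
Hypothesis hg : has_generator p g.

(** The difference quotient has a finite limit, so its numerator tends to 0. *)
Lemma transition_cvg0 (k n : int) : p t k n @[t --> 0^'+] --> p 0 k n.
Proof.
have id0 : t @[t --> (0 : R)^'+] --> (0 : R).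
  by apply: cvg_within_filter; exact: cvg_id.
have h : p 0 k n + t * ((p t k n - p 0 k n) / t) @[t --> 0^'+]
    --> p 0 k n + 0 * g k n.
  by apply: cvgD; [exact: cvg_cst|apply: cvgM => //; exact: hg].
rewrite mul0r addr0 in h.
apply: cvg_trans h; apply: near_eq_cvg; near=> t.
have t0 : 0 < t by near: t; exact: nbhs_right_gt.
by rewrite mulrC divfK ?lt0r_neq0// subrKC.
Unshelve. all: by end_near. Qed.

(** The absolute value extends [p] evenly to the whole line, where two-sided notions of limit apply;
    nothing is known of [p] at negative times. *)
Lemma transition_abs_continuous (k n : int) :
  continuous (fun t : R => p `|t| k n).
Proof.
move=> t; apply: (@cvg_dist_squeeze _ _ _ _ (fun s => 1 - p `| `|s| - `|t| | k k)).
  rewrite -[X in _ --> X](subrr (1 : R)); apply: cvgB; first exact: cvg_cst.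
  have : p s k k @[s --> 0^'+] --> (1 : R).
    by have := @transition_cvg0 k k; rewrite (transition0 hp) eqxx.
  move=> /cvgrPdist_lt p1; apply/cvgrPdist_lt => eps eps0.
  have [d /= d0 dP] := p1 _ eps0.
  have st : `|s| @[s --> t] --> `|t| by exact: norm_continuous.
  move/cvgrPdist_lt : st => /(_ _ d0).
  apply: filterS => s std.
  (* The filter [0^'+] excludes 0, so a zero increment is treated apart. *)
  have [->|st0] := eqVneq `|s| `|t|.
    by rewrite subrr normr0 (transition0 hp) eqxx subrr normr0.
  apply: dP => /=; first by rewrite sub0r normrN normr_id distrC.
  by rewrite normr_gt0 subr_eq0.
near=> s => /=.
have [ts|st] := lerP `|t| `|s|.
  rewrite -{1}(subrK `|t| `|s|).
  by apply: transition_incr_le; rewrite ?subr_ge0.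
rewrite distrC -{1}(subrK `|s| `|t|).
by apply: transition_incr_le => //; rewrite subr_ge0 ltW.
Unshelve. all: by end_near. Qed.

End generator.
End transition_function.

(** This is [(g f)(k)] for a tridiagonal matrix [g]; as a finite expression it raises no question of
    summability. *)
Definition nearest_neighbour {R : realType} (g : int -> int -> R)
    (f : int -> R) (k : int) : R :=
  g k (k + 1) * f (k + 1) + g k (k - 1) * f (k - 1) + g k k * f k.

(** * The backward equation *)

Section kolmogorov.
Context (R : realType) (p : R -> int -> int -> R) (g : int -> int -> R).
Hypothesis hp : is_transition_function p.
Hypothesis hg : has_generator p g.
Hypothesis g_row : forall k, g k (k + 1) + g k (k - 1) + g k k = 0.

(** The error [eta] is independent of [u]. This uniformity lets the same bound control left
    difference quotients, whose base point moves with the increment. *)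
Lemma transition_rate_cvg (k n : int) :
  exists2 eta : R -> R, eta s @[s --> 0^'+] --> (0 : R) &
  forall s u, 0 < s -> 0 <= u ->
    `|(p (s + u) k n - p u k n) / s - nearest_neighbour g (fun j => p u j n) k|
    <= eta s.
Proof.
pose r := [:: k + 1; k - 1; k].
have ur : uniq r.
  by rewrite /= !inE; apply/andP; split; [|rewrite andbT]; apply/negP; lia.
have sum_r (F : int -> R) : \sum_(j <- r) F j = F (k + 1) + F (k - 1) + F k.
  by rewrite !big_cons big_nil addr0 addrA.
pose dp s j := (p s k j - p 0 k j) / s.
(* The first sum is the cost of replacing the quotients [dp] by [g]. The second, with its sign, is
   the mass outside [r] divided by [s]; it tends to minus the row sum of [g], which is 0. *)
exists (fun s => \sum_(j <- r) `|dp s j - g k j| - \sum_(j <- r) dp s j).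
  have dp_cvg j : dp s j @[s --> 0^'+] --> g k j by exact: hg.
  have dist0 j : `|dp s j - g k j| @[s --> 0^'+] --> (0 : R).
    have h : `|dp s j - g k j| @[s --> 0^'+] --> `|g k j - g k j|.
      by apply: cvg_norm; apply: cvgB => //; exact: cvg_cst.
    by move: h; rewrite subrr normr0.
  under eq_fun do rewrite !sum_r.
  have c1 := cvgD (cvgD (dist0 (k + 1)) (dist0 (k - 1))) (dist0 k).
  have c2 := cvgD (cvgD (dp_cvg (k + 1)) (dp_cvg (k - 1))) (dp_cvg k).
  by have := cvgB (c1 _ _) (c2 _ _); rewrite g_row !addr0 subr0; exact.
move=> s u s0 u0.
have p0 : \sum_(j <- r) p 0 k j = 1.
  rewrite sum_r !(transition0 hp) eqxx.
  have /negPf-> : k != k + 1 by apply/negP; lia.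
  have /negPf-> : k != k - 1 by apply/negP; lia.
  by rewrite !add0r.
have p0u : \sum_(j <- r) p 0 k j * p u j n = p u k n.
  rewrite sum_r !(transition0 hp) eqxx.
  have /negPf-> : k != k + 1 by apply/negP; lia.
  have /negPf-> : k != k - 1 by apply/negP; lia.
  by rewrite !mul0r !add0r mul1r.
have /andP[lo hi] := transitionD_seq_bounds R p hp r s u k n ur (ltW s0) u0.
have -> : nearest_neighbour g (fun j => p u j n) k = \sum_(j <- r) g k j * p u j n.
  by rewrite sum_r.
have dpu : \sum_(j <- r) dp s j * p u j n =
    (\sum_(j <- r) p s k j * p u j n - p u k n) / s.
  rewrite -p0u -sumrB mulr_suml; apply: eq_bigr => j _; rewrite /dp; ring.
have dp1 : \sum_(j <- r) dp s j = (\sum_(j <- r) p s k j - 1) / s.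
  by rewrite -p0 -sumrB mulr_suml.
set a := (_ - p u k n) / s.
have a_lo : \sum_(j <- r) dp s j * p u j n <= a.
  by rewrite dpu ler_pM2r ?invr_gt0// lerD2r.
have a_hi : a <= \sum_(j <- r) dp s j * p u j n - \sum_(j <- r) dp s j.
  rewrite dpu dp1 -mulrBl ler_pM2r ?invr_gt0//; lra.
have dist : `|\sum_(j <- r) dp s j * p u j n - \sum_(j <- r) g k j * p u j n|
    <= \sum_(j <- r) `|dp s j - g k j|.
  rewrite -sumrB; apply: le_trans (ler_norm_sum _ _ _) _; apply: ler_sum => j _.
  rewrite -mulrBl normrM ler_piMr// ger0_norm ?(transition_ge0 hp)//.
  exact: (transition_le1 R p hp).
move: dist; rewrite !ler_norml => /andP[d1 d2].
by apply/andP; split; lra.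
Qed.

Lemma kolmogorov_backward (t : R) (k n : int) : 0 < t ->
  is_derive t 1 (fun s : R => p `|s| k n)
    (nearest_neighbour g (fun j => p `|t| j n) k).
Proof.
move=> t0.
have [eta eta0 etaP] := transition_rate_cvg k n.
pose G (s : R) := nearest_neighbour g (fun j => p `|s| j n) k.
have Gt : G s @[s --> t] --> G t.
  have pc j : p `|s| j n @[s --> t] --> p `|t| j n.
    exact: (transition_abs_continuous R p hp g hg).
  by apply: cvgD; [apply: cvgD|]; apply: cvgM; do ?[exact: cvg_cst|exact: pc].
suff D : h^-1 *: (p `|h *: 1 + t| k n - p `|t| k n) @[h --> 0^'] --> G t.
  apply: DeriveDef; first by apply/cvg_ex; exists (G t).
  exact/cvg_lim.
apply: (@cvg_at_right_left_dnbhs _ R^o).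
  apply: (cvg_dist_squeeze eta) => //; near=> h.
  have h0 : 0 < h by near: h; exact: nbhs_right_gt.
  rewrite /GRing.scale/= mulr1 mulrC (ger0_norm (addr_ge0 (ltW h0) (ltW t0))) /G.
  by rewrite (ger0_norm (ltW t0)); apply: etaP => //; exact: ltW.
(* For [h < 0] the quotient at [t] is the forward quotient at [h + t] with step [- h]; continuity of
   [G] then moves the base point back to [t]. *)
apply: (cvg_dist_squeeze (fun h => eta (- h) + `|G (h + t) - G t|)).
  rewrite -[X in _ --> X]addr0; apply: cvgD.
    by move/cvg_at_rightNP : eta0; rewrite oppr0.
  suff h : `|G (x + t) - G t| @[x --> 0^'-] --> `|G t - G t|.
    by move: h; rewrite subrr normr0.
  apply: cvg_norm; apply: cvgB; last exact: cvg_cst.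
  apply: cvg_within_filter.
  have : h + t @[h --> (0 : R)] --> 0 + t.
    by apply: cvgD; [exact: cvg_id|exact: cvg_cst].
  rewrite add0r => ht; exact: (cvg_comp _ _ ht Gt).
near=> h.
have h0 : h < 0 by near: h; exact: nbhs_left_lt.
have ht : 0 <= h + t.
  have : - t < h by near: h; apply: nbhs_left_gt; rewrite oppr_lt0.
  by lra.
rewrite /GRing.scale/= mulr1 mulrC (ger0_norm ht) (ger0_norm (ltW t0)).
rewrite -(subrKA (G (h + t))); apply: le_trans (ler_normD _ _) _.
rewrite lerD2r.
have := etaP (- h) (h + t); rewrite addKr oppr_gt0 h0 => /(_ isT ht).
rewrite /G (ger0_norm ht).
by rewrite invrN mulrN -mulNr opprB.
Unshelve. all: by end_near. Qed.

End kolmogorov.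

(** * Exponential series of the generator *)

Lemma is_derive_monomial {R : realType} (m : nat) (c s : R) :
  is_derive s 1 (fun x : R => x ^+ m.+1 / m.+1`!%:R * c) (s ^+ m / m`!%:R * c).
Proof.
have -> : (fun x : R => x ^+ m.+1 / m.+1`!%:R * c) =
    (c / m.+1`!%:R) \*: (@id R ^+ m.+1).
  by apply/funext => x; rewrite /= exprfctE /GRing.scale/=; ring.
have := is_deriveZ (c / m.+1`!%:R) (is_deriveX m.+1 (is_derive_id s (1:R))).
move=> h; apply: is_derive_eq; rewrite /GRing.scale/=.
have : (m`!%:R : R) != 0 by rewrite pnatr_eq0 -lt0n fact_gt0.
have : (m.+1%:R : R) != 0 by rewrite pnatr_eq0.
by rewrite factS natrM mulr1 => *; field; apply/andP.
Qed.

(** The mean value theorem shows that the bounding monomial minus [f], or plus [f], stays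
    nonnegative. Differentiability is asked only inside the interval, because an even extension may
    have a kink at 0. *)
Lemma norm_le_of_derive_monomial {R : realType} (f df : R -> R) (C T : R)
    (m : nat) (t : R) :
  f 0 = 0 -> {within `[0, T], continuous f} ->
  (forall s, 0 < s < T -> is_derive s 1 f (df s)) ->
  (forall s, 0 < s < T -> `|df s| <= s ^+ m / m`!%:R * C) ->
  0 <= t <= T -> `|f t| <= t ^+ m.+1 / m.+1`!%:R * C.
Proof.
move=> f0 fc fdf dfC /andP[]; rewrite le_eqVlt => /predU1P[<- _|t0 tT].
  by rewrite f0 normr0 expr0n !mul0r.
pose b (s : R) := s ^+ m.+1 / m.+1`!%:R * C.
have db := is_derive_monomial m C.
have bc : continuous b.
  by move=> s; apply/differentiable_continuous/derivable1_diffP; case: (db s).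
(* The sign [e] treats both halves of the absolute value at once. *)
have key (e : R) : e = 1 \/ e = -1 -> e * f t <= b t.
  move=> e1.
  have [||c ct] := @MVT R (fun s => b s - e * f s)
     (fun s => s ^+ m / m`!%:R * C - e * df s) 0 t t0.
  - move=> s; rewrite in_itv/= => /andP[s0 st].
    have hs : 0 < s < T by rewrite s0 (lt_le_trans st).
    have := fdf s hs; have := db s => d1 d2.
    have := is_deriveB d1 (is_deriveZ e d2). exact.
  - have cw : {within `[0, t], continuous f}.
      by apply: continuous_subspaceW fc; apply: subset_itvl; rewrite bnd_simp.
    move=> x; apply: cvgB; first exact: (continuous_subspaceT bc).
    by apply: cvgM; [exact: cvg_cst|exact: cw].
  rewrite f0 mulr0 subr0 /b expr0n !mul0r !subr0 => bf.
  move: ct; rewrite in_itv/= => /andP[c0 ct].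
  have hc : 0 < c < T by rewrite c0 (lt_le_trans ct).
  have := dfC c hc; rewrite ler_norml => /andP[d1 d2].
  rewrite -subr_ge0 bf; apply: mulr_ge0; last exact: ltW.
  by rewrite subr_ge0; case: e1 => ->; lra.
rewrite ler_norml; apply/andP; split.
  by have := key (-1) (or_intror erefl); rewrite /b; lra.
by have := key 1 (or_introl erefl); rewrite /b mul1r.
Qed.

Lemma is_derive_exp_sum {R : realType} (c : nat -> R) (m : nat) (s : R) :
  is_derive s 1 (fun t : R => \sum_(i < m.+1) t ^+ i / i`!%:R * c i)
    (\sum_(i < m) s ^+ i / i`!%:R * c i.+1).
Proof.
elim: m => [|m IHm].
  rewrite big_ord0; under [X in is_derive _ _ X _]funext do
    rewrite big_ord1 expr0 fact0 divr1 mul1r.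
  exact: is_derive_cst.
under [X in is_derive _ _ X _]funext do rewrite big_ord_recr/=.
rewrite big_ord_recr/=.
exact: (is_deriveD IHm (is_derive_monomial m (c m.+1) s)).
Qed.

Section taylor.
Context (R : realType) (p : R -> int -> int -> R) (g : int -> int -> R) (l : R).
Hypothesis hp : is_transition_function p.
Hypothesis hg : has_generator p g.
Hypothesis g_up : forall k, 0 <= g k (k + 1).
Hypothesis g_down : forall k, 0 <= g k (k - 1).
Hypothesis g_row : forall k, g k (k + 1) + g k (k - 1) + g k k = 0.
Hypothesis g_diag : forall k, - g k k <= l.

(** The operator [l + g] of the uniformization method: since [l] dominates the exit rates, all its
    entries are nonnegative and each row sums to [l]. *)
Definition uniformized (f : int -> R) (k : int) : R :=
  l * f k + nearest_neighbour g f k.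

Definition uniformized_pow (f : int -> R) (i : nat) : int -> R :=
  iter i uniformized f.

Let l0 : 0 <= l.
Proof.
apply: le_trans (g_diag 0); have := g_up 0; have := g_down 0.
by have := g_row 0; lra.
Qed.

Lemma uniformized_subr_sum (m : nat) (f : int -> R) (a : nat -> R)
    (h : nat -> int -> R) (k : int) :
  uniformized (fun j => f j - \sum_(i < m) a i * h i j) k =
  uniformized f k - \sum_(i < m) a i * uniformized (h i) k.
Proof.
elim: m => [|m]; first by rewrite /uniformized /nearest_neighbour !big_ord0 !subr0.
rewrite big_ord_recr/= opprD addrA => <-.
under [X in uniformized X]funext do rewrite big_ord_recr/= opprD addrA.
by rewrite /uniformized /nearest_neighbour; ring.
Qed.

Lemma uniformized_ge0 (f : int -> R) : (forall k, 0 <= f k) ->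
  forall k, 0 <= uniformized f k.
Proof.
move=> f0 k; rewrite /uniformized /nearest_neighbour.
have := f0 (k + 1); have := f0 (k - 1); have := f0 k.
by have := g_up k; have := g_down k; have := g_diag k; nra.
Qed.

(** A matrix with nonnegative entries and row sums [l] has sup-norm [l]. *)
Lemma uniformized_norm_le (f : int -> R) (C : R) :
  (forall k, `|f k| <= C) -> forall k, `|uniformized f k| <= l * C.
Proof.
move=> fC k; rewrite /uniformized /nearest_neighbour.
have := fC (k + 1); have := fC (k - 1); have := fC k.
rewrite !ler_norml => /andP[? ?] /andP[? ?] /andP[? ?].
have ? := g_up k; have ? := g_down k; have ? := g_diag k; have ? := g_row k.
rewrite [X in _ <= X <= _](_ : _ = (l + g k k) * f k
  + g k (k + 1) * f (k + 1) + g k (k - 1) * f (k - 1)); last by ring.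
have -> : l * C = (l + g k k) * C + g k (k + 1) * C + g k (k - 1) * C.
  have -> : g k k = - (g k (k + 1) + g k (k - 1)) by lra.
  by ring.
have ? : 0 <= l + g k k by lra.
by apply/andP; split; nra.
Qed.

Lemma uniformized_pow_ge0 (f : int -> R) : (forall k, 0 <= f k) ->
  forall i k, 0 <= uniformized_pow f i k.
Proof. by move=> f0; elim=> [//|i IH] k; apply: uniformized_ge0. Qed.

(** The exponential factor turns the backward equation [p' = g p] into [y' = (l + g) y]. *)
Let y n k (t : R) := expR (l * t) * p `|t| k n.

Let is_derive_y n k (t : R) : 0 < t ->
  is_derive t 1 (y n k) (uniformized (fun j => y n j t) k).
Proof.
move=> t0; have := kolmogorov_backward R p g hp hg g_row t k n t0 => dp.
have de : is_derive t 1 (fun t : R => expR (l * t)) (l * expR (l * t)).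
  rewrite mulrC; apply: (@is_derive1_comp _ expR (fun t => l * t)).
  have := @is_deriveZ R R R id l t 1 1 (is_derive_id t 1).
  by rewrite /GRing.scale /= mulr1.
have h : is_derive t 1 (y n k) _ := is_deriveM de dp.
apply: is_derive_eq; rewrite /GRing.scale/= /uniformized /nearest_neighbour /y; ring.
Qed.

Let continuous_y n k : continuous (y n k : R -> R).
Proof.
move=> t; apply: cvgM; last exact: (transition_abs_continuous R p hp g hg).
apply: (@continuous_comp R R R (fun t => l * t) expR).
  exact: mulrl_continuous.
exact: continuous_expR.
Qed.

Let remainder n m k (t : R) := y n k t -
  \sum_(i < m) t ^+ i / i`!%:R * uniformized_pow (fun j => (j == n)%:R) i k.

(** By induction on [m]: differentiating remainder [m.+1] in time gives [uniformized] applied to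
    remainder [m] in the starting state. The bound must be uniform in [k], since [uniformized] looks
    at the neighbours. The factor [expR (l * T)] bounds [y], and each step costs a factor [l]. *)
Let remainder_le n m T k t : 0 <= t <= T ->
  `|remainder n m k t| <= t ^+ m / m`!%:R * (expR (l * T) * l ^+ m).
Proof.
elim: m k t => [|m IH] k t tT.
  rewrite /remainder big_ord0 subr0 !expr0 fact0 divr1 mul1r mulr1 /y.
  case/andP : tT => t0 tT.
  rewrite ger0_norm; last by rewrite mulr_ge0 ?expR_ge0// (transition_ge0 hp).
  apply: le_trans (_ : expR (l * t) <= _).
    by rewrite ler_piMr ?expR_ge0//; apply: (transition_le1 R p hp).
  by rewrite ler_expR ler_wpM2l.
apply: (@norm_le_of_derive_monomial R (remainder n m.+1 k)
   (fun s => uniformized (fun j => remainder n m j s) k) _ T m t) => //.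
- rewrite /remainder big_ord_recl big1; last first.
    by move=> i _; rewrite expr0n/= !mul0r.
  rewrite addr0 expr0 fact0 divr1 mul1r /y mulr0 expR0 mul1r normr0.
  by rewrite (transition0 hp) subrr.
- apply: continuous_subspaceT => s; apply: cvgB; first exact: continuous_y.
  apply/differentiable_continuous/derivable1_diffP.
  by case: (is_derive_exp_sum
    (fun i => uniformized_pow (fun j => (j == n)%:R) i k) m s).
- move=> s /andP[s0 sT].
  have h : is_derive s 1 (remainder n m.+1 k) _ :=
    is_deriveB (is_derive_y n k s s0) (is_derive_exp_sum
      (fun i => uniformized_pow (fun j => (j == n)%:R) i k) m s).
  apply: is_derive_eq.
  by rewrite (uniformized_subr_sum m (fun j => y n j s)
    (fun i => s ^+ i / i`!%:R) (uniformized_pow (fun j => (j == n)%:R)) k).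
- move=> s /andP[s0 sT].
  (* One factor [l] is brought to the front, as the norm of [uniformized]. *)
  rewrite exprS mulrCA [X in _ * X]mulrCA mulrCA [X in _ * X]mulrCA.
  by apply: uniformized_norm_le => j; apply: IH; rewrite !ltW.
Qed.

Lemma transition_exp_series (t : R) (k n : int) : 0 <= t ->
  series (fun i => t ^+ i / i`!%:R * uniformized_pow (fun j => (j == n)%:R) i k)
    x @[x --> \oo] --> expR (l * t) * p t k n.
Proof.
move=> t0; apply: (cvg_dist_squeeze (fun m => exp_coeff (l * t) m * expR (l * t))).
  rewrite -[X in _ --> X](mul0r (expR (l * t))).
  by apply: cvgM; [exact: cvg_exp_coeff|exact: cvg_cst].
(* With [T = t] the remainder bound is a term of the exponential series of [l * t] times a constant,
   hence tends to 0. *)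
near=> m; have := @remainder_le n m t k t; rewrite t0 lexx => /(_ isT).
rewrite /remainder /y (ger0_norm t0) distrC /series/= big_mkord.
move=> /le_trans; apply; rewrite /exp_coeff/= exprMn le_eqVlt; apply/orP; left.
by apply/eqP; ring.
Unshelve. all: by end_near. Qed.

End taylor.

(** * Generating function of the chain *)

(** An explicit enumeration of the integers turns [\esum] over [int] into a series over [nat], for
    which interchange with other series and with integrals is available. *)
Definition int_enum (i : nat) : int := if odd i then Negz i./2 else Posz i./2.

Lemma int_enum_bij : set_bij [set: nat] [set: int] int_enum.
Proof.
split => //.
- move=> i j _ _; rewrite /int_enum => ij.
  rewrite -(odd_double_half i) -(odd_double_half j).
  by move: ij; case: (odd i) (odd j) => [] [] // [->].
- move=> [] n _; [exists n.*2|exists n.*2.+1] => //; rewrite /int_enum.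
    by rewrite odd_double doubleK.
  by rewrite oddS odd_double/= uphalf_double.
Qed.

Lemma esum_intE {R : realType} (a : int -> \bar R) : (forall n, 0 <= a n)%E ->
  (\esum_(n in [set: int]) a n = \sum_(0 <= i <oo) a (int_enum i))%E.
Proof.
by move=> a0; rewrite (reindex_esum _ _ _ _ int_enum_bij) nneseries_esumT.
Qed.

Lemma esum_intZl {R : realType} (a : int -> \bar R) (c : R) :
  (forall n, 0 <= a n)%E -> 0 <= c ->
  (\esum_(n in [set: int]) (c%:E * a n) = c%:E * \esum_(n in [set: int]) a n)%E.
Proof.
move=> a0 c0; rewrite !esum_intE//; first exact: nneseriesZl.
by move=> n; rewrite mule_ge0.
Qed.

Lemma nneseries_EFin {R : realType} (a : nat -> R) (s : R) :
  series a x @[x --> \oo] --> s -> (\sum_(0 <= i <oo) (a i)%:E = s%:E)%E.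
Proof.
move=> as_; apply/cvg_lim => //; under eq_fun do rewrite sumEFin.
by apply/cvg_EFin => //; exact: nearW.
Qed.

Section generating_function.
Context (R : realType) (p : R -> int -> int -> R) (g : int -> int -> R) (l : R).
Hypothesis hp : is_transition_function p.
Hypothesis hg : has_generator p g.
Hypothesis g_up : forall k, 0 <= g k (k + 1).
Hypothesis g_down : forall k, 0 <= g k (k - 1).
Hypothesis g_row : forall k, g k (k + 1) + g k (k - 1) + g k k = 0.
Hypothesis g_diag : forall k, - g k k <= l.

Let pow := uniformized_pow R g l.
Let delta n := (fun j : int => (j == n)%:R : R).

Let pow_delta_ge0 n i k : 0 <= pow (delta n) i k.
Proof. by apply: (uniformized_pow_ge0 R g l) => // j; rewrite ler0n. Qed.

(** The function [uniformized_pow] of the indicator of [n], taken at [k], is the entry [(k, n)] of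
    the matrix power, so the sum is a matrix-vector product. The induction splits off one factor,
    which has three nonnegative entries per row. *)
Lemma esum_uniformized_pow (u : int -> R) (i : nat) (k : int) :
  (forall n, 0 <= u n) ->
  (\esum_(n in [set: int]) (u n * uniformized_pow R g l (fun j => (j == n)%:R) i k)%:E
  = (uniformized_pow R g l u i k)%:E)%E.
Proof.
move=> u0; elim: i k => [|i IH] k.
  rewrite (@esum_seq_setC _ _ [:: k])// ?big_seq1/=.
    rewrite eqxx mulr1 esum1 ?adde0// => j /= jk.
    have /negPf-> : k != j by apply/negP => /eqP kj; apply: jk; rewrite /= inE kj.
    by rewrite mulr0.
  by move=> j; rewrite mulr_ge0.
have ud0 n j : (0 <= (u n * pow (delta n) i j)%:E)%E.
  by rewrite lee_fin mulr_ge0.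
have l0 j : 0 <= l + g j j by have := g_diag j; lra.
transitivity (\esum_(n in [set: int])
   ((l + g k k)%:E * (u n * pow (delta n) i k)%:E +
    (g k (k + 1))%:E * (u n * pow (delta n) i (k + 1))%:E +
    (g k (k - 1))%:E * (u n * pow (delta n) i (k - 1))%:E)%E).
  apply: eq_esum => n _; rewrite -!EFinM -!EFinD; congr (_%:E).
  by rewrite /pow /= /uniformized /nearest_neighbour; ring.
rewrite !esumD; try by move=> n _; rewrite ?adde_ge0// mule_ge0// lee_fin.
rewrite !esum_intZl// !IH -!EFinM -!EFinD; congr (_%:E).
by rewrite /= /uniformized /nearest_neighbour; ring.
Qed.

Lemma uniformized_pow_eigen (v w : int -> R) (x y : R) (i : nat) (k : int) :
  (forall j, nearest_neighbour g v j = x * v j) ->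
  (forall j, nearest_neighbour g w j = y * w j) ->
  uniformized_pow R g l (fun j => v j + w j) i k =
  (l + x) ^+ i * v k + (l + y) ^+ i * w k.
Proof.
move=> vx wy; elim: i k => [|i IH] k; first by rewrite !expr0 !mul1r.
rewrite /uniformized_pow iterS -/(uniformized_pow _ _ _ _ i) /uniformized.
have -> : uniformized_pow R g l (fun j => v j + w j) i =
    (fun j => (l + x) ^+ i * v j + (l + y) ^+ i * w j) by apply/funext.
transitivity ((l + x) ^+ i * (l * v k + nearest_neighbour g v k) +
              (l + y) ^+ i * (l * w k + nearest_neighbour g w k)).
  by rewrite /nearest_neighbour; ring.
by rewrite vx wy !exprSr; ring.
Qed.

(** The exponential series of [p] is summed over [n] first, by Tonelli. Only [v + w] is required to
    be nonnegative, because one of the two eigenfunctions may take negative values. *)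
Lemma esum_transition_eigen (v w : int -> R) (x y t : R) (k : int) : 0 <= t ->
  (forall j, nearest_neighbour g v j = x * v j) ->
  (forall j, nearest_neighbour g w j = y * w j) ->
  (forall j, 0 <= v j + w j) ->
  (\esum_(n in [set: int]) ((v n + w n) * p t k n)%:E =
   (v k * expR (x * t) + w k * expR (y * t))%:E)%E.
Proof.
move=> t0 vx wy vw0.
(* The factor [E] cancels the [expR (l * t)] that comes with the series for [p t k n]. *)
pose E := expR (- (l * t)).
have EE : E * expR (l * t) = 1 by rewrite /E -expRD addNr expR0.
pose u n := E * v n + E * w n.
have u0 n : 0 <= u n by rewrite /u -mulrDr mulr_ge0// expR_ge0.
pose c n i := t ^+ i / i`!%:R * pow (delta n) i k.
have c0 n i : 0 <= c n i by rewrite !mulr_ge0// ?exprn_ge0.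
transitivity (\esum_(n in [set: int]) \sum_(0 <= i <oo) (u n * c n i)%:E)%E.
  apply: eq_esum => n _.
  under eq_eseriesr do rewrite EFinM.
  rewrite nneseriesZl; last by move=> i _; rewrite lee_fin.
  rewrite (nneseries_EFin _ _ (transition_exp_series R p g l hp hg
    g_up g_down g_row g_diag t k n t0)).
  rewrite -EFinM -[in LHS](mul1r (v n + w n)) -EE /u; congr (_%:E); ring.
rewrite esum_intE; last first.
  by move=> n; apply: nneseries_ge0 => i _ _; rewrite lee_fin mulr_ge0.
rewrite nneseries_interchange; last by move=> i j; rewrite lee_fin mulr_ge0.
transitivity (\sum_(0 <= i <oo) (t ^+ i / i`!%:R * pow u i k)%:E)%E.
  apply: eq_eseriesr => i _.
  rewrite -(esum_intE (fun n => (u n * c n i)%:E)); last first.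
    by move=> n; rewrite lee_fin mulr_ge0.
  rewrite EFinM -esum_uniformized_pow// -esum_intZl; last 2 first.
  - by move=> n; rewrite lee_fin mulr_ge0// pow_delta_ge0.
  - by rewrite mulr_ge0 ?exprn_ge0.
  by apply: eq_esum => n _; rewrite -EFinM /c mulrCA.
apply: nneseries_EFin.
have -> : series (fun i => t ^+ i / i`!%:R * pow u i k) =
   (fun m => series (exp_coeff ((l + x) * t)) m * (E * v k)
           + series (exp_coeff ((l + y) * t)) m * (E * w k)).
  apply/funext => m; rewrite /series/= !mulr_suml -big_split; apply: eq_bigr => i _.
  rewrite /pow (uniformized_pow_eigen _ _ x y) => [|j|j].
  - by rewrite /exp_coeff/= !exprMn; ring.
  - by rewrite mulrCA -vx /nearest_neighbour; ring.
  - by rewrite mulrCA -wy /nearest_neighbour; ring.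
have -> : v k * expR (x * t) + w k * expR (y * t) =
    expR ((l + x) * t) * (E * v k) + expR ((l + y) * t) * (E * w k).
  rewrite !mulrDl !expRD /E expRN.
  have : expR (l * t) != 0 by rewrite gt_eqF// expR_gt0.
  by move=> ?; field.
by apply: cvgD; apply: cvgM; first [exact: is_cvg_series_exp_coeff|exact: cvg_cst].
Qed.

End generating_function.

Lemma even_intS (k : int) : even_int (k + 1) = ~~ even_int k.
Proof. by rewrite /even_int; lia. Qed.

Lemma even_intB1 (k : int) : even_int (k - 1) = ~~ even_int k.
Proof. by rewrite -[in RHS](subrK 1 k) even_intS negbK. Qed.

(** * Spectral analysis of the alternating generator *)

Section alternating.
Context (R : realType) (a1 a2 b1 b2 : R).
Hypothesis a1_gt0 : 0 < a1.
Hypothesis a2_gt0 : 0 < a2.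
Hypothesis b1_gt0 : 0 < b1.
Hypothesis b2_gt0 : 0 < b2.

Let g := alternating_generator a1 a2 b1 b2.

Lemma alternating_generatorE (k : int) :
  [/\ g k (k + 1) = if even_int k then a1 else b1,
      g k (k - 1) = if even_int k then a2 else b2 &
      g k k = - (if even_int k then a1 + a2 else b1 + b2)].
Proof.
rewrite /g /alternating_generator eqxx.
have /negPf-> : k - 1 != k + 1 by apply/negP; lia.
have /negPf-> : k != k + 1 by apply/negP; lia.
have /negPf-> : k != k - 1 by apply/negP; lia.
by rewrite !eqxx; case: even_int.
Qed.

Lemma hfun_gt0 (z : R) : 0 < z -> 0 < hfun a1 a2 b1 b2 z.
Proof.
move=> z0; rewrite /hfun mulr_gt0 ?invr_gt0// sqrtr_gt0.
apply: ltr_wpDl; first by rewrite mulr_ge0 ?sqr_ge0.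
by rewrite !mulr_gt0// addr_gt0// mulr_gt0// exprn_gt0.
Qed.

Lemma hfun_sqr (z : R) : 0 < z -> hfun a1 a2 b1 b2 z ^+ 2 =
  (a1 + a2 - (b1 + b2)) ^+ 2 * z ^+ 2 / 4 +
  (b1 * z ^+ 2 + b2) * (a1 * z ^+ 2 + a2).
Proof.
move=> z0; rewrite /hfun exprMn sqr_sqrtr; first by field.
apply: addr_ge0; first by rewrite mulr_ge0 ?sqr_ge0.
by rewrite ltW// !mulr_gt0// addr_gt0// mulr_gt0// exprn_gt0.
Qed.

(* The generator acts as a 2 x 2 matrix on [z ^ k] times a function of the
   parity of [k]; its eigenvectors are obtained for [h = hfun z] and
   [h = - hfun z]. *)
Definition parity_eigenfun (z h : R) (k : int) : R :=
  z ^ k * ((1 + cfun a1 a2 b1 b2 k z / h) / 2).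

Lemma parity_eigenfunE (z h : R) : 0 < z -> h != 0 ->
  h ^+ 2 = hfun a1 a2 b1 b2 z ^+ 2 -> forall k,
  nearest_neighbour g (parity_eigenfun z h) k =
  (- ((a1 + a2 + b1 + b2) / 2) + h / z) * parity_eigenfun z h k.
Proof.
move=> z0 h0 hh k; rewrite hfun_sqr// in hh.
have z1 : z != 0 by rewrite gt_eqF.
rewrite /nearest_neighbour; have [-> -> ->] := alternating_generatorE k.
rewrite /parity_eigenfun !exprzDr ?unitfE// expr1z exprN1 /cfun.
rewrite even_intS even_intB1; case: even_int => /=.
  set co := (a1 + a2 - (b1 + b2)) * z / 2 + b1 * z ^+ 2 + b2.
  set ce := (b1 + b2 - (a1 + a2)) * z / 2 + a1 * z ^+ 2 + a2.
  (* The difference of the two sides is exactly the defect in the equation for [h ^+ 2], up to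
     sign. *)
  have E : (a1 * z ^+ 2 + a2) * (h + co) = (h + (a1 + a2 - (b1 + b2)) * z / 2) * (h + ce).
    apply/eqP; rewrite -subr_eq0; apply/eqP.
    transitivity (- (h ^+ 2 - ((a1 + a2 - (b1 + b2)) ^+ 2 * z ^+ 2 / 4 +
      (b1 * z ^+ 2 + b2) * (a1 * z ^+ 2 + a2)))); last by rewrite hh subrr oppr0.
    by rewrite /co /ce; field.
  transitivity (z ^ k / (2 * z * h) * ((a1 * z ^+ 2 + a2) * (h + co)) -
     (a1 + a2) * z ^ k * (h + ce) / (2 * h)).
    by field; apply/andP.
  by rewrite E; field; apply/andP.
set co := (b1 + b2 - (a1 + a2)) * z / 2 + a1 * z ^+ 2 + a2.
set ce := (a1 + a2 - (b1 + b2)) * z / 2 + b1 * z ^+ 2 + b2.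
have E : (b1 * z ^+ 2 + b2) * (h + co) = (h + (b1 + b2 - (a1 + a2)) * z / 2) * (h + ce).
  apply/eqP; rewrite -subr_eq0; apply/eqP.
  transitivity (- (h ^+ 2 - ((a1 + a2 - (b1 + b2)) ^+ 2 * z ^+ 2 / 4 +
    (b1 * z ^+ 2 + b2) * (a1 * z ^+ 2 + a2)))); last by rewrite hh subrr oppr0.
  by rewrite /co /ce; field.
transitivity (z ^ k / (2 * z * h) * ((b1 * z ^+ 2 + b2) * (h + co)) -
   (b1 + b2) * z ^ k * (h + ce) / (2 * h)).
  by field; apply/andP.
by rewrite E; field; apply/andP.
Qed.

(** With [e], [P] and [Q] as below, [cfun] is [P - e] or [Q + e], and [h ^+ 2 = e ^+ 2 + Q * P]
    forces [|e| < h]. The consequence is that the exponential with rate [hhat_plus] has a positive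
    coefficient. *)
Lemma cfun_gtN (k : int) (z : R) : 0 < z ->
  - hfun a1 a2 b1 b2 z < cfun a1 a2 b1 b2 k z.
Proof.
move=> z0; have h0 := hfun_gt0 z z0; have := hfun_sqr z z0.
have P0 : 0 < a1 * z ^+ 2 + a2 by rewrite addr_gt0// mulr_gt0// exprn_gt0.
have Q0 : 0 < b1 * z ^+ 2 + b2 by rewrite addr_gt0// mulr_gt0// exprn_gt0.
rewrite /cfun; move: (hfun _ _ _ _ _) h0 => h h0.
set P := a1 * _ + _ in P0 *; set Q := b1 * _ + _ in Q0 *.
set e := (a1 + a2 - (b1 + b2)) * z / 2 => hh.
have he : h ^+ 2 = e ^+ 2 + Q * P by rewrite hh /e; field.
have eh : `|e| < h.
  have h1 := ltW h0.
  by rewrite -ltr_sqr ?nnegrE// real_normK ?num_real// he ltrDl mulr_gt0.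
move: eh; rewrite ltr_norml => /andP[e1 e2].
case: even_int; rewrite -addrA -/P -/Q; last by lra.
have -> : (b1 + b2 - (a1 + a2)) * z / 2 = - e by rewrite /e; field.
by lra.
Qed.

Lemma hhat_minus_lt0 (z : R) : 0 < z -> hhat_minus a1 a2 b1 b2 z < 0.
Proof.
move=> z0; rewrite /hhat_minus subr_lt0.
by rewrite (lt_trans (y := 0)) ?oppr_lt0 ?divr_gt0 ?addr_gt0 ?hfun_gt0.
Qed.

Lemma alternating_chain_pgf (p : R -> int -> int -> R) (z t : R) (k : int) :
  is_transition_function p -> has_generator p g -> 0 < z -> 0 <= t ->
  (\esum_(n in [set: int]) (z ^ n * p t k n)%:E =
   (parity_eigenfun z (hfun a1 a2 b1 b2 z) k * expR (hhat_plus a1 a2 b1 b2 z * t)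
    + parity_eigenfun z (- hfun a1 a2 b1 b2 z) k
      * expR (hhat_minus a1 a2 b1 b2 z * t))%:E)%E.
Proof.
move=> hp hg z0 t0; have h0 := hfun_gt0 z z0.
have sum_v j : parity_eigenfun z (hfun a1 a2 b1 b2 z) j +
    parity_eigenfun z (- hfun a1 a2 b1 b2 z) j = z ^ j.
  by rewrite /parity_eigenfun invrN mulrN; field; rewrite gt_eqF.
under eq_esum do rewrite -sum_v.
(* The sum of all four rates dominates both exit rates [a1 + a2] and [b1 + b2]. *)
apply: (esum_transition_eigen R p g (a1 + a2 + b1 + b2) hp hg) => //.
- by move=> j; have [-> _ _] := alternating_generatorE j; case: even_int; rewrite ltW.
- by move=> j; have [_ -> _] := alternating_generatorE j; case: even_int; rewrite ltW.
- by move=> j; have [-> -> ->] := alternating_generatorE j; case: even_int; ring.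
- move=> j; have [_ _ ->] := alternating_generatorE j.
  have := (a1_gt0, a2_gt0, b1_gt0, b2_gt0) => -[[[? ?] ?] ?].
  by case: even_int; rewrite opprK; lra.
- by apply: parity_eigenfunE => //; rewrite gt_eqF.
- move=> j; rewrite parity_eigenfunE// ?oppr_eq0 ?gt_eqF// ?sqrrN//.
  by rewrite /hhat_minus mulNr.
- by move=> j; rewrite sum_v exprz_ge0// ltW.
Qed.

End alternating.

(** * Laplace transform of the tempered stable subordinator *)

Section density.
Import HBNNSimple.

(** Monotone convergence along simple functions reduces the claim to indicators, where it is the
    defining property of the density. *)
Lemma ge0_integral_density {d} {T : measurableType d} {R : realType}
    (mu nu : {measure set T -> \bar R}) (f : T -> R) (h : T -> \bar R) :
  measurable_fun [set: T] f -> (forall x, 0 <= f x) ->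
  (forall A, measurable A -> nu A = \int[mu]_(x in A) (f x)%:E)%E ->
  measurable_fun [set: T] h -> (forall x, 0 <= h x)%E ->
  (\int[nu]_x h x = \int[mu]_x (h x * (f x)%:E))%E.
Proof.
move=> mf f0 nuE mh h0.
have mfE : measurable_fun [set: T] (EFin \o f) by exact/measurable_EFinP.
have h_lim x := @cvg_nnsfun_approx d T R _ measurableT h mh (fun x _ => h0 x) x I.
pose hn := nnsfun_approx measurableT mh.
have nd_hn x m n : (m <= n)%N -> ((hn m x)%:E <= (hn n x)%:E)%E.
  by move=> mn; rewrite lee_fin; exact/lefP/nd_nnsfun_approx.
have mhn n : measurable_fun [set: T] (EFin \o hn n).
  by apply/measurable_EFinP; exact: measurable_funP.
have -> : (\int[nu]_x h x = limn (fun n => \int[nu]_x (hn n x)%:E))%E.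
  rewrite -monotone_convergence//; last 2 first.
  - by move=> n x _; rewrite lee_fin.
  - by move=> x _ m n; exact: nd_hn.
  by apply: eq_integral => x _; apply/esym/cvg_lim => //; exact: h_lim.
have -> : (\int[mu]_x (h x * (f x)%:E) =
    limn (fun n => \int[mu]_x ((hn n x)%:E * (f x)%:E)))%E.
  rewrite -monotone_convergence//; last 3 first.
  - by move=> n; apply: emeasurable_funM; [exact: mhn|exact: mfE].
  - by move=> n x _; rewrite mule_ge0 ?lee_fin.
  - by move=> x _ m n mn; rewrite lee_wpmul2r ?lee_fin//; exact: nd_hn.
  apply: eq_integral => x _; apply/esym/cvg_lim => //.
  by apply: cvgeZr => //; exact: h_lim.
congr (limn _); apply/funext => n.
have mind r : measurable_fun [set: T]
    (fun x => (r * \1_(hn n @^-1` [set r]) x)%:E).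
  by apply/measurable_EFinP; exact: measurable_funM.
transitivity (\int[nu]_x (\sum_(y \in range (hn n))
    (y * \1_(hn n @^-1` [set y]) x)%:E))%E.
  by apply: eq_integral => x _; rewrite [in LHS]fimfunE -fsumEFin.
rewrite ge0_integral_fsum//; last by move=> y x _; exact: nnfun_muleindic_ge0.
transitivity (\int[mu]_x (\sum_(y \in range (hn n))
    ((y * \1_(hn n @^-1` [set y]) x)%:E * (f x)%:E)))%E; last first.
  apply: eq_integral => x _.
  rewrite -ge0_mule_fsuml => [|y]; last exact: nnfun_muleindic_ge0.
  by rewrite fsumEFin// -fimfunE.
rewrite ge0_integral_fsum//; last 2 first.
- by move=> y; apply: emeasurable_funM; [exact: mind|exact: mfE].
- by move=> y x _; apply: mule_ge0; [exact: nnfun_muleindic_ge0|rewrite lee_fin].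
apply: eq_fsbigr => r /[!inE] -[x0 _ rE].
have r0 : (0 <= r%:E)%E by rewrite -rE lee_fin.
rewrite integralZl_indic_nnsfun//.
under [RHS]eq_integral do rewrite EFinM -muleA.
rewrite ge0_integralZl//; last 2 first.
- by apply: emeasurable_funM => //; exact/measurable_EFinP.
- by move=> x _; rewrite mule_ge0 ?lee_fin.
under [in RHS]eq_integral do rewrite muleC.
rewrite [X in _ = (_ * X)%E](eq_integral ((EFin \o f) \_ (hn n @^-1` [set r]))); last first.
  by move=> x _; rewrite epatch_indic.
by rewrite -integral_mkcond integral_indic// setIT nuE.
Qed.

End density.

Section laplace.
Context {R : realType}.

Lemma expectation_expR_density {d} {T : measurableType d}
    (P : probability T R) (Y : {RV P >-> R}) (f : R -> R) (c : R) :
  is_density Y f ->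
  ('E_P[fun w => expR (c * Y w)] =
   \int[lebesgue_measure]_x (expR (c * x) * f x)%:E)%E.
Proof.
move=> [mf f0 fE].
have mexp : measurable_fun [set: R] (fun x => expR (c * x)).
  by apply: measurableT_comp => //; exact: measurable_funM.
(* The library gives [R] and [measurableTypeR R], on which [lebesgue_measure]
   lives, distinct but convertible sigma-algebras. *)
have mY : measurable_fun [set: T] (Y : T -> measurableTypeR R).
  move=> _ B mB; have := @measurable_funP _ _ _ _ setT Y measurableT B; apply; exact: mB.
pose Y' : {mfun T >-> measurableTypeR R} :=
  HB.pack (Y : T -> measurableTypeR R) (isMeasurableFun.Build _ _ _ _ _ mY).
rewrite unlock.
transitivity (\int[distribution P Y']_x (expR (c * x))%:E)%E.
  by rewrite ge0_integral_distribution//; exact/measurable_EFinP.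
under [RHS]eq_integral do rewrite EFinM.
by apply: ge0_integral_density => //; exact/measurable_EFinP.
Qed.

(** Tempering multiplies the density by [expR (- (mu * x))] and a constant, which shifts the Laplace
    argument from [c] to [c - mu]. The two subordinators may live on different spaces, as they are
    compared only through densities. *)
Lemma tempered_stable_laplace {d0 d} {T0 : measurableType d0}
    {T : measurableType d} (P0 : probability T0 R) (P : probability T R)
    (S0 : R -> {RV P0 >-> R}) (St : R -> {RV P >-> R}) (f : R -> R -> R)
    (nu mu t c : R) :
  0 < nu -> 0 < t -> is_stable_subordinator nu S0 -> is_density (S0 t) (f t) ->
  is_tempered_stable_subordinator nu mu f St ->
  ('E_P[fun w => expR (c * St t w)] =
   if (c <= mu)%R then (expR (- t * ((mu - c) `^ nu - mu `^ nu)))%:E else +oo)%E.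
Proof.
move=> nu0 t0 [_ S0L] fd [_ Std].
rewrite (expectation_expR_density _ _ _ _ (Std t t0)).
have fm : measurable_fun [set: R] (fun x => expR ((c - mu) * x) * f t x).
  by case: fd => mf _ _; apply: measurable_funM => //;
    apply: measurableT_comp => //; exact: measurable_funM.
transitivity ((expR (mu `^ nu * t))%:E * 'E_P0[fun w => expR ((c - mu) * S0 t w)])%E.
  rewrite (expectation_expR_density _ _ _ _ fd) -ge0_integralZl//; last 2 first.
  - exact/measurable_EFinP.
  - by move=> x _; case: fd => _ f0 _; rewrite lee_fin mulr_ge0 ?expR_ge0.
  apply: eq_integral => x _; rewrite -EFinM mulrA mulrA; congr ((_ * _)%:E).
  by rewrite -!expRD; congr expR; ring.
rewrite S0L// subr_le0; case: ifPn => cmu; last by rewrite gt0_muley// lte_fin expR_gt0.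
rewrite -EFinM -expRD ler0_norm ?subr_le0// opprB; congr (expR _)%:E; ring.
Qed.
End laplace.

(** * Independent time change *)

(** The successor makes the value strictly larger than [x >= 0] even when [x] is a grid point. The
    approximation thus stays within [x^'+], and its values are positive times. *)
Definition upper_grid {R : realType} (m : nat) (x : R) : R :=
  (Num.trunc (m.+1%:R * x)).+1%:R / m.+1%:R.

Lemma upper_grid_gt {R : realType} (m : nat) (x : R) : 0 <= x ->
  x < upper_grid m x.
Proof.
move=> x0; rewrite /upper_grid ltr_pdivlMr// (mulrC x).
by case/andP: (truncn_itv (mulr_ge0 (ler0n R m.+1) x0)).
Qed.

Lemma upper_grid_le {R : realType} (m : nat) (x : R) : 0 <= x ->
  upper_grid m x <= x + m.+1%:R^-1.
Proof.
move=> x0; rewrite /upper_grid ler_pdivrMr// mulrDl mulVf// -natr1 lerD2r (mulrC x).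
by case/andP: (truncn_itv (mulr_ge0 (ler0n R m.+1) x0)).
Qed.

Lemma upper_grid_near {R : realType} (x : R) (Q : set R) : 0 <= x ->
  (\forall y \near x^'+, Q y) -> \forall m \near \oo, Q (upper_grid m x).
Proof.
move=> x0 [e /= e0 xQ]; near=> m; apply: xQ; last exact: upper_grid_gt.
rewrite /= ltr0_norm ?subr_lt0 ?upper_grid_gt// opprB ltrBlDl.
apply: le_lt_trans (upper_grid_le m x x0) _; rewrite ltrD2l.
by near: m; exact: (near_infty_natSinv_lt (PosNum e0)).
Unshelve. all: by end_near. Qed.

Lemma upper_grid_cvg {R : realType} (x : R) : 0 <= x ->
  upper_grid m x @[m --> \oo] --> x.
Proof.
move=> x0; apply/cvgrPdist_lt => e e0.
apply: (upper_grid_near x [set y | `|x - y| < e]) => //.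
have : y @[y --> x^'+] --> x by apply: cvg_within_filter; exact: cvg_id.
by move/cvgrPdist_lt; apply.
Qed.

Section mixture.
Context {d} {T : measurableType d} {R : realType} (P : probability T R).
Context (X : R -> T -> int) (Y : {RV P >-> R}) (n : int).
Hypothesis X_measurable : forall s, 0 <= s -> measurable [set w | X s w = n].
Hypothesis X_rcont : forall w (t : R), 0 <= t ->
  \forall s \near t^'+, X s w = X t w.
Hypothesis Y_ge0 : forall w, 0 <= Y w.

Let grid m j : R := j.+1%:R / m.+1%:R.
Let cell m j : set R := [set` `[j%:R / m.+1%:R, j.+1%:R / m.+1%:R[ ].
Let E m j := Y @^-1` cell m j.

Let grid_ge0 m j : 0 <= grid m j.
Proof. by rewrite divr_ge0. Qed.

Let mE m j : measurable (E m j).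
Proof.
rewrite -[E m j]setTI.
exact: (@measurable_funP _ _ _ _ setT Y measurableT _ (measurable_itv _)).
Qed.

Let cell_trunc m j w : E m j w -> Num.trunc (m.+1%:R * Y w) = j.
Proof.
rewrite /E /= /cell /= in_itv/= ler_pdivrMr// ltr_pdivlMr// => /andP[h1 h2].
by apply: truncn_def; rewrite mulrC h1.
Qed.

Let upper_gridE m j w : E m j w -> upper_grid m (Y w) = grid m j.
Proof. by move=> /cell_trunc; rewrite /upper_grid => ->. Qed.

Let bigcup_E m : \bigcup_j E m j = [set: T].
Proof.
apply/seteqP; split => // w _; exists (Num.trunc (m.+1%:R * Y w)) => //.
rewrite /E /= /cell /= in_itv/= ler_pdivrMr// ltr_pdivlMr// mulrC.
by apply: truncn_itv; rewrite mulr_ge0.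
Qed.

Let trivIset_E m : trivIset [set: nat] (E m).
Proof.
apply/trivIsetP => i j _ _ ij; apply/seteqP; split => // w [Ei Ej].
by move: ij; rewrite -(cell_trunc _ _ _ Ei) -(cell_trunc _ _ _ Ej) eqxx.
Qed.

Let hit m : set T := [set w | X (upper_grid m (Y w)) w = n].

Let hitE m : hit m = \bigcup_j ([set w | X (grid m j) w = n] `&` E m j).
Proof.
apply/seteqP; split => w.
  move=> hw; have : [set: T] w by []; rewrite -(bigcup_E m) => -[j _ Ej].
  by exists j => //; split => //=; rewrite -(upper_gridE m j w).
by move=> [j _ [/= Xn Ej]]; rewrite /hit/= (upper_gridE m j w).
Qed.

Let measurable_hit m : measurable (hit m).
Proof.
rewrite hitE; apply: bigcup_measurable => j _.
by apply: measurableI => //; exact: X_measurable.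
Qed.

Let hit_cvg (C : set T) w : \1_(C `&` hit m) w @[m --> \oo]
  --> (\1_(C `&` [set w | X (Y w) w = n]) w : R).
Proof.
apply: cvg_near_cst; have := upper_grid_near (Y w) _ (Y_ge0 w) (X_rcont w _ (Y_ge0 w)).
apply: filterS => m Xm; rewrite !indicE; congr (_%:R); congr nat_of_bool.
by apply/idP/idP; rewrite !inE /hit /= Xm.
Qed.

(** By right continuity, at each [w] the indicators of [hit m] are eventually constant, equal to the
    indicator of this event. *)
Lemma measurable_time_change : measurable [set w | X (Y w) w = n].
Proof.
apply/(@measurable_indicP _ _ R).
apply: (@measurable_fun_cvg _ _ _ _ (fun m => \1_(hit m))).
  by move=> m; apply/measurable_indicP; exact: measurable_hit.
move=> w _; have := hit_cvg setT w.
by under eq_fun do rewrite setTI; rewrite setTI.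
Qed.

(** To be used with [C] the starting event and [q s] the transition probability. The identity is
    exact for each grid approximation, by summing over cells; both sides then converge by dominated
    convergence, from right continuity of [X] and continuity of [q]. *)
Lemma time_change_mixture (C : set T) (q : R -> R) : measurable C ->
  continuous q -> (forall s, 0 <= q s <= 1) ->
  (forall (s : R) (B : set R), (0 < s)%R -> measurable B ->
    P (C `&` [set w | X s w = n] `&` Y @^-1` B) =
    P C * (q s)%:E * P (Y @^-1` B))%E ->
  (P (C `&` [set w | X (Y w) w = n]) = P C * \int[P]_w (q (Y w))%:E)%E.
Proof.
move=> mC qc q01 indep.
have q0 s : 0 <= q s by case/andP: (q01 s).
have q1 s : q s <= 1 by case/andP: (q01 s).
have mqgrid m : measurable_fun [set: T] (fun w => q (upper_grid m (Y w))).
  (* The function is constant on each of the countably many cells. *)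
  rewrite -(bigcup_E m); apply/measurable_fun_bigcup => // j.
  apply: (eq_measurable_fun (fun=> q (grid m j))); last exact: measurable_cst.
  by move=> w; rewrite inE => /upper_gridE ->.
have grid_mixture m :
    (P (C `&` hit m) = P C * \int[P]_w (q (upper_grid m (Y w)))%:E)%E.
  rewrite hitE setI_bigcupr measure_bigcup; last 2 first.
  - by move=> j _; apply: measurableI => //; apply: measurableI => //; exact: X_measurable.
  - by apply: trivIset_setIl; apply: trivIset_setIl.
  rewrite -(bigcup_E m) ge0_integral_bigcup//; last 2 first.
  - by rewrite bigcup_E; exact/measurable_EFinP.
  - by move=> w _; rewrite lee_fin.
  rewrite -[P C]fineK ?fin_num_measure// -nneseriesZl; last first.
    by move=> j _; apply: integral_ge0 => w _; rewrite lee_fin.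
  rewrite (@eq_eseriesl _ (fun x => x \in [set: nat]) xpredT); last first.
    by move=> j; rewrite in_setT.
  apply: eq_eseriesr => j _.
  rewrite setIA; transitivity (P C * (q (grid m j))%:E * P (E m j))%E.
    by apply: indep; [rewrite divr_gt0|exact: measurable_itv].
  rewrite fineK ?fin_num_measure// -muleA; congr (_ * _)%E.
  rewrite (eq_integral (cst (q (grid m j))%:E)) ?integral_cst//.
  by move=> w; rewrite inE => /upper_gridE ->.
have mqY : measurable_fun [set: T] (q \o Y).
  by apply: measurableT_comp; [exact: continuous_measurable_fun|exact: measurable_funP].
have int1 : P.-integrable setT (EFin \o cst (1 : R)).
  exact: finite_measure_integrable_cst.
have limR : (P C * \int[P]_w (q (upper_grid m (Y w)))%:E @[m --> \oo]
    --> P C * \int[P]_w (q (Y w))%:E)%E.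
  apply: cvgeZl; first exact: fin_num_measure.
  apply: (@dominated_cvg _ _ _ _ _ measurableT _ _ (EFin \o cst 1)) => //.
  - by move=> m; exact/measurable_EFinP.
  - move=> w _; apply: cvg_EFin; first exact: nearW.
    exact: (cvg_comp _ _ (upper_grid_cvg _ (Y_ge0 w)) (qc (Y w))).
  - by move=> m w _ /=; rewrite lee_fin ger0_norm.
have mind m : measurable (C `&` hit m) by apply: measurableI => //; exact: measurable_hit.
have limL : (P (C `&` hit m) @[m --> \oo] -->
    P (C `&` [set w | X (Y w) w = n]))%E.
  rewrite -[X in _ --> P X]setIT -integral_indic//; last first.
    by apply: measurableI => //; exact: measurable_time_change.
  under eq_fun do rewrite -[X in P X]setIT -integral_indic//.
  apply: (@dominated_cvg _ _ _ _ _ measurableT _ _ (EFin \o cst 1)) => //.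
  - by move=> m; apply/measurable_EFinP/measurable_indicP.
  - by move=> w _; apply: cvg_EFin; [exact: nearW|exact: hit_cvg].
  - move=> m w _ /=; rewrite lee_fin ger0_norm// indicE; by case: (_ \in _).
rewrite (funext grid_mixture) in limL.
exact: (cvg_unique _ limL limR).
Qed.

End mixture.

Lemma process_sigma_measurable {d} {T : measurableType d} {R : realType}
    {U : Type} (G : set (set U)) (X : R -> T -> U) (t : R) (B : set U) :
  0 <= t -> G B -> process_sigma G X (X t @^-1` B).
Proof.
by move=> t0 GB; apply: sub_sigma_algebra; exists t => //; exists B.
Qed.

Lemma process_sigmaI {d} {T : measurableType d} {R : realType}
    {U : Type} (G : set (set U)) (X : R -> T -> U) (A B : set T) :
  process_sigma G X A -> process_sigma G X B -> process_sigma G X (A `&` B).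
Proof.
exact: (@measurableI _ (g_sigma_algebraType
  [set X t @^-1` B | t in [set t : R | 0 <= t] & B in G])).
Qed.

(** * Expectations of combinations of two exponentials *)

Section expR_combination.
Context {d} {T : measurableType d} {R : realType} (P : probability T R).
Context (Y : {RV P >-> R}) (a b x y : R).

Let e c w := expR (c * Y w).

Let measurable_e c : measurable_fun [set: T] (e c).
Proof.
apply: measurableT_comp => //; exact: measurable_funM.
Qed.

Let integrable_e c r : ('E_P[e c] = r%:E)%E ->
  P.-integrable [set: T] (EFin \o e c).
Proof.
rewrite unlock => er; apply/integrableP; split; first exact/measurable_EFinP.
under eq_integral do rewrite /= ger0_norm ?expR_ge0//.
by rewrite er ltry.
Qed.

Lemma expectation_expR_combination (ex ey : R) :
  ('E_P[fun w => expR (x * Y w)] = ex%:E)%E ->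
  ('E_P[fun w => expR (y * Y w)] = ey%:E)%E ->
  (\int[P]_w (a * expR (x * Y w) + b * expR (y * Y w))%:E =
   (a * ex + b * ey)%:E)%E.
Proof.
move=> hx hy; have ix := integrable_e x ex hx; have iy := integrable_e y ey hy.
under eq_integral do rewrite EFinD !EFinM.
rewrite integralD//; try exact: integrableZl.
by rewrite !integralZl//; move: hx hy; rewrite unlock => -> ->.
Qed.

Lemma expectation_expR_combination_pinfty (ey : R) : 0 < a ->
  (forall w, 0 <= a * expR (x * Y w) + b * expR (y * Y w)) ->
  ('E_P[fun w => expR (x * Y w)] = +oo)%E ->
  ('E_P[fun w => expR (y * Y w)] = ey%:E)%E ->
  (\int[P]_w (a * expR (x * Y w) + b * expR (y * Y w))%:E = +oo)%E.
Proof.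
move=> a0 ab0; rewrite unlock => hx hy.
have mab : measurable_fun [set: T]
    (fun w => (a * expR (x * Y w) + b * expR (y * Y w))%:E).
  by apply/measurable_EFinP; apply: measurable_funD;
    apply: measurable_funM; do ?[exact: measurable_cst|exact: measurable_e].
have me c : measurable_fun [set: T] (EFin \o e c) by exact/measurable_EFinP.
have e0 c w : (0 <= (EFin \o e c) w)%E by rewrite lee_fin expR_ge0.
(* Since [b] may be negative, the integrand cannot be split directly. Adding [|b|] times the second
   exponential, of finite expectation, gives an upper bound for the first term, whose integral is
   infinite. *)
have : (\int[P]_w (a%:E * (e x w)%:E) <=
    \int[P]_w ((a * e x w + b * e y w)%:E + `|b|%:E * (e y w)%:E))%E.
  apply: ge0_le_integral => //.
  - by move=> w _; apply: mule_ge0; [rewrite lee_fin ltW|exact: e0].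
  - by apply: emeasurable_funM => //; exact: me.
  - by apply: emeasurable_funD => //; apply: emeasurable_funM => //; exact: me.
  - move=> w _; rewrite -!EFinM -EFinD lee_fin -addrA lerDl -mulrDl.
    rewrite mulr_ge0 ?expR_ge0// -lerBlDr sub0r lerNl.
    by have := ler_norm (- b); rewrite normrN.
rewrite ge0_integralZl//; [|exact: me|by move=> w _; exact: e0|by rewrite lee_fin ltW].
rewrite hx gt0_muley ?lte_fin// ge0_integralD//; last 3 first.
- by move=> w _; rewrite lee_fin ab0.
- by move=> w _; rewrite mule_ge0 ?lee_fin ?expR_ge0.
- by apply: emeasurable_funM => //; exact: me.
rewrite ge0_integralZl//; [|exact: me|by move=> w _; exact: e0].
rewrite [X in (_ * X)%E]hy -EFinM.
by case: (\int[P]_w _)%E.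
Qed.

End expR_combination.

Lemma markov_chain_pair {d} {T : measurableType d} {R : realType}
    (P : probability T R) (p : R -> int -> int -> R) (X : R -> T -> int)
    (s : R) (k n : int) : is_markov_chain P p X -> 0 < s ->
  (P ([set w | X 0%R w = k] `&` [set w | X s w = n]) =
   P [set w | X 0%R w = k] * (p s k n)%:E)%E.
Proof.
move=> hX s0.
(* The Markov property is applied at the times 0 and [s]; the multiples of [s] continue them to a
   strictly increasing sequence. *)
pose t (j : nat) := j%:R * s; pose i (j : nat) := if j is 0%N then k else n.
have t_incr : {homo t : a b / (a < b)%N >-> a < b}.
  by move=> a b ab; rewrite /t ltr_pM2r// ltr_nat.
have := chain_markov hX 1 i _ t_incr; rewrite {1}/t mul0r lexx => /(_ isT).
rewrite big_ord1 /t mul0r mul1r subr0 /= => <-; congr (P _).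
apply/seteqP; split => w /=.
  by move=> [Xk Xn] [|[|//]] _ /=; rewrite ?mul0r ?mul1r.
by move=> h; have := h 0%N isT; have := h 1%N isT; rewrite /= mul0r mul1r.
Qed.

Lemma subordinator_ge0 {d} {T : measurableType d} {R : realType}
    (P : probability T R) (S : R -> {RV P >-> R}) (t : R) (w : T) :
  is_subordinator S -> 0 <= t -> 0 <= S t w.
Proof.
by move=> hS t0; rewrite -(subordinator_start hS w); exact: (subordinator_homo hS).
Qed.

Lemma integral_countable_fibers {d} {T : measurableType d} {R : realType}
    (P : probability T R) (N : T -> int) (B : set T) (u : int -> R) :
  (forall n, measurable [set w | N w = n]) -> measurable B ->
  (forall n, 0 <= u n) ->
  (\int[P]_(w in B) (u (N w))%:E =
   \esum_(n in [set: int]) ((u n)%:E * P ([set w | N w = n] `&` B)))%E.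
Proof.
move=> mN mB u0.
pose F i := [set w | N w = int_enum i] `&` B.
have mF i : measurable (F i) by exact: measurableI.
have FB : B = \bigcup_i F i.
  rewrite -setI_bigcupl (_ : \bigcup_i _ = setT) ?setTI//.
  apply/seteqP; split => // w _; have [_ _ surj] := int_enum_bij.
  by have [i _ iN] := surj (N w) I; exists i.
rewrite {1}FB ge0_integral_bigcup//; last 3 first.
- apply/measurable_fun_bigcup => // i.
  apply: (eq_measurable_fun (fun=> (u (int_enum i))%:E)) => //.
  by move=> w; rewrite inE => -[/= ->].
- by move=> w _; rewrite lee_fin.
- apply/trivIsetP => i j _ _ ij; apply/seteqP; split => // w [[/= Ni _] [/= Nj _]].
  have [_ inj _] := int_enum_bij.
  by move: ij; rewrite (inj i j) ?eqxx ?inE// -Ni.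
rewrite esum_intE; last by move=> n; rewrite mule_ge0 ?lee_fin.
apply: eq_eseriesr => i _.
rewrite (eq_integral (cst (u (int_enum i))%:E)) ?integral_cst//.
by move=> w; rewrite inE => -[/= ->].
Qed.

Theorem proposition5p1 (R : realType) (a1 a2 b1 b2 nu mu : R)
  (a1_gt0 : 0 < a1) (a2_gt0 : 0 < a2) (b1_gt0 : 0 < b1) (b2_gt0 : 0 < b2)
  (nu_gt0 : 0 < nu) (nu_lt1 : nu < 1) (mu_ge0 : 0 <= mu)
  (d0 : measure_display) (T0 : measurableType d0) (P0 : probability T0 R)
  (S0 : R -> {RV P0 >-> R}) (f : R -> R -> R)
  (S0_stable : is_stable_subordinator nu S0)
  (f_density : forall t : R, 0 < t -> is_density (S0 t) (f t))
  (d : measure_display) (T : measurableType d) (P : probability T R)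
  (p : R -> int -> int -> R) (X : R -> T -> int) (St : R -> {RV P >-> R})
  (X_chain : is_markov_chain P p X)
  (p_generator : has_generator p (alternating_generator a1 a2 b1 b2))
  (St_tempered : is_tempered_stable_subordinator nu mu f St)
  (X_St_independent :
    independent_sigma P (process_sigma [set: set int] X)
                        (process_sigma (@measurable _ R) St)) :
  let Xt : R -> T -> int := time_change X St in
  forall (k : int) (t : R), 0 < t ->
  (0 < P [set w | Xt 0%R w = k])%E ->
  forall z : R, 0 < z ->
  let F := cond_pgf P Xt k z t in
  let hp := hhat_plus a1 a2 b1 b2 z in
  let hm := hhat_minus a1 a2 b1 b2 z in
  let ep := expR (- t * ((mu - hp) `^ nu - mu `^ nu)) in
  let em := expR (- t * ((mu - hm) `^ nu - mu `^ nu)) in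
  [/\ F = (\esum_(n in [set: int])
             ((z ^ n)%R%:E * cond_prob P [set w | Xt t w = n]
                                       [set w | Xt 0%R w = k]))%E,
      hp <= mu ->
        F = (z ^ k * ((ep + em) / 2 +
               cfun a1 a2 b1 b2 k z / hfun a1 a2 b1 b2 z * ((ep - em) / 2)))%:E &
      ~~ (hp <= mu) -> F = +oo%E].
Proof.
move=> Xt k t t0 PC0 z z0 F hp hm ep em.
have p_transition := chain_transition X_chain.
have St_sub : is_subordinator St by case: St_tempered.
have Y0 w : 0 <= St t w by apply: subordinator_ge0 => //; exact: ltW.
pose C := [set w | X 0 w = k].
(* The subordinator starts at 0, so both processes have the same starting event. *)
have CE : [set w | Xt 0 w = k] = C.
  by apply/seteqP; split => w; rewrite /= /Xt /time_change (subordinator_start St_sub).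
rewrite CE in PC0.
have mX s n : 0 <= s -> measurable [set w | X s w = n].
  by move=> s0; exact: (chain_measurable X_chain [set n]).
have mC : measurable C by exact: mX.
have mXt n : measurable [set w | Xt t w = n].
  apply: (@measurable_time_change _ _ _ P X (St t) n) => //.
    by move=> s; exact: mX.
  exact: chain_rcont X_chain.
pose r := fine (P C).
have PC : P C = r%:E by rewrite fineK// fin_num_measure.
have r0 : 0 < r by rewrite -lte_fin -PC.
have div_PC (x : \bar R) : (x / P C = x * (r^-1)%:E)%E.
  by rewrite PC inver gt_eqF.
have zn0 n : 0 <= z ^ n by rewrite exprz_ge0// ltW.
have FE : F = (\esum_(n in [set: int])
    ((z ^ n)%R%:E * cond_prob P [set w | Xt t w = n] C))%E.
  rewrite /F /cond_pgf /cond_expectation CE.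
  rewrite (integral_countable_fibers P (Xt t) C (fun n => z ^ n))//.
  rewrite div_PC muleC -esum_intZl; last 2 first.
  - by move=> n; rewrite mule_ge0 ?lee_fin.
  - by rewrite invr_ge0 ltW.
  apply: eq_esum => n _; rewrite /cond_prob div_PC [LHS]muleCA.
  by congr (_ * _)%E; exact: muleC.
(* Conditionally on the start, the law at time [t] is the transition law of the chain averaged over
   [St t]. *)
have condE n : cond_prob P [set w | Xt t w = n] C =
    (\int[P]_w (p (St t w) k n)%:E)%E.
  rewrite /cond_prob div_PC setIC.
  have -> : (\int[P]_w (p (St t w) k n)%:E = \int[P]_w (p `|St t w| k n)%:E)%E.
    by apply: eq_integral => w _; rewrite ger0_norm.
  rewrite (@time_change_mixture _ _ _ P X (St t) n _ _ _ C (fun s => p `|s| k n))//.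
  - by rewrite PC muleAC -EFinM mulfV ?mul1e// gt_eqF.
  - by move=> s; exact: mX.
  - exact: chain_rcont X_chain.
  - exact: (transition_abs_continuous R p p_transition _ p_generator).
  - by move=> s; rewrite (transition_ge0 p_transition)// (transition_le1 R p p_transition).
  move=> s B s0 mB; rewrite ger0_norm ?(ltW s0)//.
  rewrite X_St_independent ?(markov_chain_pair P p X)//.
    apply: process_sigmaI; first exact: (process_sigma_measurable _ X 0 [set k]).
    by apply: (process_sigma_measurable _ X s [set n]) => //; exact: ltW.
  by apply: process_sigma_measurable => //; exact: ltW.
pose h := hfun a1 a2 b1 b2 z.
have h0 : 0 < h by exact: hfun_gt0.
pose A := parity_eigenfun R a1 a2 b1 b2 z h k.
pose B := parity_eigenfun R a1 a2 b1 b2 z (- h) k.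
have pgf w : (\esum_(n in [set: int]) (z ^ n * p (St t w) k n)%:E =
    (A * expR (hp * St t w) + B * expR (hm * St t w))%:E)%E.
  exact: alternating_chain_pgf.
have p0 w n : 0 <= p (St t w) k n by exact: (transition_ge0 p_transition).
(* Tonelli exchanges the sum over [n] with the expectation, which leaves the generating function of
   the chain at the random time. *)
have FI : F = (\int[P]_w (A * expR (hp * St t w) + B * expR (hm * St t w))%:E)%E.
  have mp n : measurable_fun [set: T] (fun w => p (St t w) k n).
    rewrite (_ : (fun w => _) = (fun s => p `|s| k n) \o St t); last first.
      by apply/funext => w /=; rewrite ger0_norm.
    apply: measurableT_comp; last exact: measurable_funP.
    apply: continuous_measurable_fun.
    exact: (transition_abs_continuous R p p_transition _ p_generator).
  rewrite FE; under eq_integral do rewrite -pgf.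
  under eq_esum do rewrite condE.
  rewrite esum_intE; last first.
    by move=> n; rewrite mule_ge0 ?lee_fin// integral_ge0// => w _; rewrite lee_fin.
  under [RHS]eq_integral => w _.
    rewrite esum_intE; last by move=> n; rewrite lee_fin mulr_ge0.
    over.
  rewrite integral_nneseries//; last 2 first.
  - by move=> n; apply/measurable_EFinP/measurable_funM.
  - by move=> n w _; rewrite lee_fin mulr_ge0.
  apply: eq_eseriesr => i _; under [RHS]eq_integral do rewrite EFinM.
  rewrite ge0_integralZl// ?lee_fin//; last by move=> w _; rewrite lee_fin.
  exact/measurable_EFinP.
have laplace c := @tempered_stable_laplace R d0 d T0 T P0 P S0 St f nu mu t c
  nu_gt0 t0 S0_stable (f_density t t0) St_tempered.
(* Hence [hm <= mu] always: only the exponential with rate [hp] can have infinite expectation. *)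
have hm0 : hm < 0 by exact: hhat_minus_lt0.
have Em : ('E_P[fun w => expR (hm * St t w)] = em%:E)%E.
  by rewrite laplace (le_trans (ltW hm0)).
split; first by rewrite CE.
- move=> hpmu; rewrite FI (expectation_expR_combination P (St t) A B hp hm ep em)//.
    congr (_%:E); rewrite /A /B /parity_eigenfun -/h.
    by rewrite invrN mulrN; field; rewrite gt_eqF.
  by rewrite laplace hpmu.
- move=> hpmu; rewrite FI.
  apply: (expectation_expR_combination_pinfty P (St t) A B hp hm em) => //.
  + rewrite /A /parity_eigenfun mulr_gt0 ?exprz_gt0// divr_gt0//.
    rewrite addrC -ltrBlDr sub0r ltr_pdivlMr// mulN1r.
    exact: cfun_gtN.
  (* The combination is nonnegative as a generating function, whatever the sign of [B]. *)
  + by move=> w; rewrite -lee_fin -pgf esum_ge0// => n _; rewrite lee_fin mulr_ge0.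
  + by rewrite laplace (negPf hpmu).
Qed.
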